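(* Let $N$ be the scheduled arrival process with i.i.d. perturbations $(\xi_j)_{j\in\mathbb{Z}}$ (defined in the context), and let $(V_i:i\ge1)$ be an i.i.d. sequence of nonnegative random variables (service requirements), independent of $N$. For $t\ge0$ put $$\Lambda(t)=\sum_{i=1}^{N(t)}V_i,\qquad \Lambda'(t)=\sum_{i=1}^{\lfloor t\rfloor}V_i.$$ Suppose that $\mathbb{E}|\xi_0|<\infty$ and $\mathbb{E}V_1^p<\infty$ for some $p>2$. Then $$\frac{1}{\sqrt t}\,\sup_{0\le s\le t}|\Lambda(s)-\Lambda'(s)|\Rightarrow0$$ as $t\to\infty$, where $\Rightarrow$ denotes convergence in distribution.
   Context: $(\xi_j:j\in\mathbb{Z})$ is an i.i.d. sequence of real-valued random variables and $U$ is uniform on $[0,1]$, independent of $(\xi_j)$. Customer $j\in\mathbb{Z}$ arrives at time $j+\xi_j+U$, and $N(t)=\sum_{j\in\mathbb{Z}}I(j+\xi_j+U\in(0,t])$ is the number of arrivals in $(0,t]$, $t\ge0$. *)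

(* Defs.v *)
From HB Require Import structures.
From mathcomp Require Import all_boot all_order all_algebra finmap.
From mathcomp Require Import all_classical all_reals all_analysis.
From mathcomp Require Import measurable_realfun.

Set Implicit Arguments.
Unset Strict Implicit.
Unset Printing Implicit Defensive.

Import Order.TTheory GRing.Theory Num.Theory.
Import numFieldNormedType.Exports.

Local Open Scope classical_set_scope.
Local Open Scope ring_scope.

Section independence.
Context (d : measure_display) (T : measurableType d) (R : realType)
  (P : probability T R).

Definition mutually_independent (I : choiceType) (X : I -> {RV P >-> R}) :=
  forall (J : {fset I}) (B : I -> set R), (forall j, measurable (B j)) ->
    P (\bigcap_(j in [set` J]) (X j @^-1` B j)) =
    (\prod_(j <- J) P (X j @^-1` B j))%E.

(* The laws are compared on Borel sets only: as functions on [set R], the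
   pushforwards also take (irrelevant) values at non-measurable sets. *)
Definition identically_distributed (I : Type) (X : I -> {RV P >-> R}) :=
  forall i j (B : set R), measurable B ->
    distribution P (X i) B = distribution P (X j) B.

Definition iid (I : choiceType) (X : I -> {RV P >-> R}) :=
  mutually_independent X /\ identically_distributed X.

(* The sigma-algebra on T generated by the maps X i, i in D. *)
Definition sigma_of (I : Type) (d' : measure_display) (E : measurableType d')
    (D : set I) (X : I -> T -> E) : set (set T) :=
  <<s \bigcup_(i in D) preimage_set_system setT (X i) measurable >>.

Definition independent_systems (F G : set (set T)) :=
  forall A B, F A -> G B -> P (A `&` B) = (P A * P B)%E.

End independence.

Definition uniform01 (d : measure_display) (T : measurableType d)
    (R : realType) (P : probability T R) (U : {RV P >-> R}) :=
  forall B : set R, measurable B ->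
    distribution P U B = uniform_prob (@ltr01 R) B.

Definition cvg_in_distribution (d : measure_display) (T : measurableType d)
    (R : realType) (P : probability T R)
    (Y : R -> {RV P >-> R}) (Z : {RV P >-> R}) :=
  forall f : R -> R, continuous f -> (exists M : R, forall x, `|f x| <= M) ->
    ('E_P[f \o Y t])%E @[t --> +oo] --> ('E_P[f \o Z])%E.

Section scheduled_traffic.
Context (T : Type) (R : realType).

(* Number of arrivals in (0, t]. It is extended-real valued, since infinitely
   many arrivals may fall in (0, t] for exceptional w. *)
Definition arrivals (xi : int -> T -> R) (U : T -> R) (t : R) (w : T)
    : \bar R :=
  \esum_(j in [set: int])
    (\1_(`]0, t]%classic : set R) (j%:~R + xi j w + U w))%:E.

(* V i is the (i+1)-st service requirement, so the sum over the i with
   i + 1 <= N(t) is V_1 + ... + V_N(t); it is the whole series when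
   N(t) = +oo. *)
Definition Lambda (V : nat -> T -> R) (N : R -> T -> \bar R) (t : R) (w : T)
    : \bar R :=
  (\sum_(0 <= i <oo | (i.+1%:R%:E <= N t w)%E) (V i w)%:E)%E.

Definition Lambda' (V : nat -> T -> R) (t : R) (w : T) : R :=
  \sum_(i < Num.truncn t) V i w.

Definition scaled_sup (V : nat -> T -> R) (N : R -> T -> \bar R) (t : R)
    (w : T) : \bar R :=
  ((Num.sqrt t)^-1%:E *
   ereal_sup [set `|Lambda V N s w - (Lambda' V s w)%:E|
             | s in [set s : R | (0 <= s <= t)%R]])%E.

End scheduled_traffic.

(* Main.v *)
Require Import Defs.
From HB Require Import structures.
From mathcomp Require Import all_boot all_order all_algebra finmap.
From mathcomp Require Import all_classical all_reals all_analysis.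
From mathcomp Require Import measurable_realfun.
From mathcomp Require Import zify ring lra.

Set Implicit Arguments.
Unset Strict Implicit.
Unset Printing Implicit Defensive.

Import Order.TTheory GRing.Theory Num.Theory.
Import numFieldNormedType.Exports.

Local Open Scope classical_set_scope.
Local Open Scope ring_scope.

(* Call customer j displaced at k when |j - k| <= 1 + |xi_j|. Since 0 <= U <= 1,
   a customer on the wrong side of a time s in [k, k + 1) is displaced at 0 or at
   k, so |N(s) - k| is at most the number of displaced customers at 0 and at k.
   Each of these numbers counts independent events whose probabilities add up to
   at most 3 + 2 E|xi_0|, hence has a tail O(2^-m) uniformly in k. So, up to
   probability O(t 2^-m), |N(s) - floor s| <= 2m for all s <= t, and then
   |Lambda(s) - Lambda'(s)| is at most 2m times the largest of the first t + 2m
   service requirements. With m of order 2 log_2 t, Markov's inequality for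
   V^p, p > 2, makes this o(sqrt t) in probability. *)

(** * Counting integers through finite windows *)

Lemma sum_pred_count (R : pzSemiRingType) (I : Type) (a : pred I) (s : seq I) :
  \sum_(i <- s) (a i)%:R = (count a s)%:R :> R.
Proof.
by rewrite -sum1_count natr_sum [RHS]big_mkcond/=; apply: eq_bigr => i _; case: (a i).
Qed.

Lemma esum_count_ge (R : realType) (I : choiceType) (a : pred I) (s : seq I) :
  uniq s -> ((count a s)%:R%:E <= \esum_(j in [set: I]) ((a j)%:R : R)%:E)%E.
Proof.
move=> us; apply: esum_ge; exists [set` s]; first by split.
by rewrite -fsbig_seq//= sumEFin sum_pred_count.
Qed.

Lemma esum_count_le (R : realType) (I : choiceType) (a : pred I) (x : \bar R) :
  (forall s : seq I, uniq s -> ((count a s)%:R%:E <= x)%E) ->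
  (\esum_(j in [set: I]) ((a j)%:R : R)%:E <= x)%E.
Proof.
move=> h; apply: ge_ereal_sup => _ [A [fA _] <-].
by rewrite fsbig_finite//= sumEFin sum_pred_count; exact/h/fset_uniq.
Qed.

(** Listing the interval [[k - n, k + n)] as two rays starting at [k] turns a count by distance to
    [k] into two counts over [iota 0 n]. *)
Definition window (k : int) (n : nat) : seq int :=
  [seq k + i%:Z | i <- iota 0 n] ++ [seq k - i.+1%:Z | i <- iota 0 n].

Lemma mem_window k n (j : int) :
  (j \in window k n) = (k - n%:Z <= j) && (j < k + n%:Z).
Proof.
rewrite mem_cat; apply/idP/idP.
  by case/orP => /mapP[i]; rewrite mem_iota => ? ->; lia.
move=> h; have [kj|kj] := leP k j; apply/orP; [left|right]; apply/mapP.
  by exists `|j - k|%N; rewrite ?mem_iota; lia.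
by exists (`|k - j|%N.-1); rewrite ?mem_iota; lia.
Qed.

Lemma window_uniq k n : uniq (window k n).
Proof.
rewrite cat_uniq !map_inj_in_uniq ?iota_uniq ?andbT/=; last 2 first.
- by move=> i j _ _; lia.
- by move=> i j _ _; lia.
by apply/hasPn => _ /mapP[i _ ->]; apply/mapP => -[i' _]; lia.
Qed.

Lemma sub_window k (s : seq int) : exists n, {subset s <= window k n}.
Proof.
elim: s => [|j s [n sn]]; first by exists 0%N.
exists (maxn n (`|j - k|%N.+1)) => i; rewrite inE => /predU1P[->|/sn];
  rewrite !mem_window; lia.
Qed.

Lemma count_sub (I : eqType) (a : pred I) (s s' : seq I) :
  uniq s -> {subset s <= s'} -> (count a s <= count a s')%N.
Proof.
move=> us ss'; rewrite -!size_filter; apply: uniq_leq_size.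
  exact: filter_uniq.
by move=> i; rewrite !mem_filter => /andP[-> /ss'].
Qed.

(** * Displaced customers and the number of arrivals *)

Definition arrived (R : realType) (a : int -> R) (s : R) (j : int) :=
  0 < a j <= s.

(** The condition on [j] involves the perturbation [x j] alone and not [U], so for i.i.d.
    perturbations these events are independent over [j]. *)
Definition displaced (R : realType) (x : int -> R) (k j : int) :=
  `|j - k|%:~R <= 1 + `|x j|.

Lemma count_predU_le (I : Type) (a b : pred I) (s : seq I) :
  (count (predU a b) s <= count a s + count b s)%N.
Proof. by rewrite -count_predUI leq_addr. Qed.

Section arrivals_bounds.
Context (R : realType) (x a : int -> R) (m : nat) (s : R).
Hypotheses (xa : forall j, j%:~R + x j <= a j <= j%:~R + x j + 1) (s0 : 0 <= s).
Let k := Num.truncn s.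
Hypothesis few_displaced : forall c : int, c = 0 \/ c = k ->
  forall n, (count (displaced x c) (window c n) <= m)%N.

Let K := [seq i%:Z | i <- iota 1 k].

Let mem_K (j : int) : (j \in K) = (1 <= j <= k%:Z).
Proof.
apply/mapP/idP => [[i]|h]; first by rewrite mem_iota => ? ->; lia.
by exists `|j|%N; rewrite ?mem_iota; lia.
Qed.

Let uniq_K : uniq K.
Proof. by rewrite map_inj_uniq ?iota_uniq// => i j []. Qed.

Let count_displaced (c : int) (F : seq int) : c = 0 \/ c = k -> uniq F ->
  (count (displaced x c) F <= m)%N.
Proof.
move=> /few_displaced ckm uF; have [n Fn] := sub_window c F.
exact: leq_trans (count_sub _ uF Fn) (ckm n).
Qed.

(** Without perturbation exactly the customers in [K] would have arrived. One with [j <= 0] who has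
    arrived is late past 0, one in [K] who has not is early past 0 or late past [k], and one with
    [j > k] who has arrived is early past [k]. The slack 1 in [displaced] absorbs the offset of
    [a j] when late, and the fractional part of [s] in the last case. *)
Let arrivedP j : (arrived a s j) != (j \in K) -> displaced x 0 j || displaced x k j.
Proof.
have [ks sk] : k%:R <= s /\ s < k%:R + 1.
  by have := truncn_itv s0; rewrite -natr1 => /andP.
have /andP[xa1 xa2] := xa j.
have := ler_norm (x j); have := ler_norm (- x j); rewrite normrN => h1 h2.
have [j0|j0] := leP j 0.
  have jR : j%:~R <= 0 :> R by rewrite (_ : 0 = 0%:~R)// ler_int.
  rewrite mem_K (_ : (1 <= j <= k%:Z) = false); last lia.
  rewrite eqbF_neg negbK => /andP[a0 _]; rewrite /displaced subr0.
  rewrite ler0_norm// intrN; apply/orP; left; lra.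
have jR : 1 <= j%:~R :> R by rewrite (_ : 1 = 1%:~R)// ler_int.
have [jk|jk] := leP j k.
  have jkR : j%:~R <= k%:R :> R by rewrite (_ : k%:R = k%:~R)// ler_int.
  rewrite mem_K (_ : (1 <= j <= k%:Z) = true); last lia.
  rewrite eqb_id /arrived negb_and -leNgt -ltNge => /orP[a0|sa].
    by apply/orP; left; rewrite /displaced subr0 ger0_norm ?(ltW j0)//; lra.
  apply/orP; right; rewrite /displaced ler0_norm ?subr_le0// opprB intrD intrN.
  rewrite -pmulrn; lra.
have jkR : k%:R + 1 <= j%:~R :> R.
  by rewrite (_ : _ + _ = (k%:Z + 1)%:~R) ?ler_int ?intrD//; lia.
rewrite mem_K (_ : (1 <= j <= k%:Z) = false); last lia.
rewrite eqbF_neg negbK => /andP[_ a_s]; apply/orP; right.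
rewrite /displaced ger0_norm ?subr_ge0 ?(ltW jk)// intrD intrN -pmulrn; lra.
Qed.

Lemma arrived_le (F : seq int) : uniq F -> (count (arrived a s) F <= k + 2 * m)%N.
Proof.
move=> uF.
apply: (@leq_trans (count (predU (mem K) (predU (displaced x 0) (displaced x k))) F)).
  apply: sub_count => j aj /=; case: (boolP (j \in K)) => //= jK.
  by apply: arrivedP; rewrite aj (negbTE jK).
apply: leq_trans (count_predU_le _ _ _) _; apply: leq_add.
  rewrite -size_filter -[k in leqRHS](size_iota 1) -(size_map Posz).
  apply: uniq_leq_size; first exact: filter_uniq.
  by move=> j; rewrite mem_filter => /andP[].
apply: leq_trans (count_predU_le _ _ _) _; rewrite mul2n -addnn.
by apply: leq_add; apply: count_displaced => //; [left|right].
Qed.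

Lemma arrived_ge : exists2 F, uniq F & (k - 2 * m <= count (arrived a s) F)%N.
Proof.
(* Members of [K] who have not arrived are displaced at 0 or at [k], so at most [2 * m] of the [k]
   members are missing. *)
exists K => //; rewrite leq_subLR addnC.
have -> : k = count predT K by rewrite count_predT size_map size_iota.
apply: (@leq_trans (count (predU (arrived a s)
    (predU (displaced x 0) (displaced x k))) K)).
  rewrite -!size_filter; apply: uniq_leq_size; first exact: filter_uniq.
  move=> j; rewrite !mem_filter/= => jK; rewrite jK andbT.
  case: (boolP (arrived a s j)) => //= aj.
  by apply: arrivedP; rewrite (negbTE aj) jK.
apply: leq_trans (count_predU_le _ _ _) _; rewrite leq_add2l.
apply: leq_trans (count_predU_le _ _ _) _; rewrite mul2n -addnn.
by apply: leq_add; apply: count_displaced => //; [left|right].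
Qed.

End arrivals_bounds.

Lemma arrivals_esum (T : Type) (R : realType) (xi : int -> T -> R) (U : T -> R) t w :
  arrivals xi U t w =
  \esum_(j in [set: int])
    ((arrived (fun j => j%:~R + xi j w + U w) t j)%:R : R)%:E.
Proof.
rewrite /arrivals; apply: eq_esum => j _.
by rewrite indicE mem_setE in_itv.
Qed.

(** * Comparing the two workloads pathwise *)

Lemma Lambda_bounds (T : Type) (R : realType) (V : nat -> T -> R) N t w lo hi :
  (forall i, 0 <= V i w) -> (lo%:R%:E <= N t w)%E -> (N t w <= hi%:R%:E)%E ->
  ((\sum_(i < lo) V i w)%:E <= Lambda V N t w)%E /\
  (Lambda V N t w <= (\sum_(i < hi) V i w)%:E)%E.
Proof.
move=> V0 lN Nh; rewrite /Lambda; split.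
  apply: le_trans (nneseries_lim_ge lo _); last by move=> i _ _; rewrite lee_fin.
  rewrite -sumEFin -(big_mkord xpredT (fun i => (V i w)%:E)).
  rewrite [leLHS]big_nat_cond [leRHS]big_nat_cond.
  rewrite [leRHS](eq_bigl (fun i => (0 <= i < lo)%N && true))// => i.
  rewrite andbT; case: (boolP (0 <= i < lo)%N) => //= il.
  by rewrite (le_trans _ lN)// lee_fin ler_nat; lia.
apply: lime_le; first by apply: is_cvg_nneseries => i _ _; rewrite lee_fin.
near=> n.
have hn : (hi <= n)%N by near: n; exact: nbhs_infty_ge.
(* A term of index [i] survives the filter only if [i + 1 <= N t w <= hi], so partial sums beyond
   [hi] add nothing. *)
rewrite -sumEFin -(big_mkord xpredT (fun i => (V i w)%:E)).
rewrite big_nat_cond big_mkcond/= [leRHS](big_nat_widen _ _ _ _ _ hn).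
rewrite big_mkcond [leRHS]big_mkcond; apply: lee_sum => i _ /=.
case: ifPn => [iN|_]; last by case: ifP; rewrite ?lee_fin.
by have := le_trans iN Nh; rewrite lee_fin ler_nat => ->.
Unshelve. all: end_near. Qed.

(** Since [V] is nonnegative, [Lambda] lies between the sums of the first [k - m] and the first
    [k + m] requirements, and each of these differs from [Lambda'] by at most [m] terms bounded by
    [v]. *)
Lemma Lambda_diff_le (T : Type) (R : realType) (V : nat -> T -> R) N s w m v :
  (forall i, 0 <= V i w) ->
  (forall i, (i < Num.truncn s + m)%N -> V i w <= v) -> 0 <= v ->
  ((Num.truncn s - m)%:R%:E <= N s w)%E -> (N s w <= (Num.truncn s + m)%:R%:E)%E ->
  (`|Lambda V N s w - (Lambda' V s w)%:E| <= (m%:R * v)%:E)%E.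
Proof.
set k := Num.truncn s => V0 Vv v0 lN Nh.
have [lL Lh] := Lambda_bounds V0 lN Nh.
have gap n r : (n + r <= k + m)%N ->
    \sum_(i < n + r) V i w <= \sum_(i < n) V i w + r%:R * v.
  move=> nr; rewrite big_split_ord/= lerD2l mulr_natl -[r in leRHS]card_ord.
  by rewrite -sumr_const; apply: ler_sum => i _; apply: Vv; have := ltn_ord i; lia.
have : Lambda V N s w \is a fin_num.
  rewrite ge0_fin_numE; first exact: le_lt_trans Lh (ltry _).
  by apply: le_trans lL; rewrite lee_fin; apply: sumr_ge0.
case: (Lambda V N s w) lL Lh => // L; rewrite !lee_fin => lL Lh _.
have kV : Lambda' V s w <= \sum_(i < k - m) V i w + m%:R * v.
  (* When [k < m] the truncated difference is 0, and all of [Lambda'] consists of fewer than [m]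
     terms. *)
  have [mk|km] := leqP m k.
    by have := @gap (k - m)%N m; rewrite subnK//; apply; lia.
  rewrite (_ : (k - m = 0)%N); last lia.
  rewrite big_ord0 add0r; have := @gap 0%N k; rewrite add0n big_ord0 add0r.
  move=> /(_ (leq_addr _ _)) /le_trans; apply.
  by rewrite ler_wpM2r// ler_nat ltnW.
have kh : \sum_(i < k + m) V i w <= Lambda' V s w + m%:R * v by exact: gap.
rewrite ler_norml; apply/andP; split; lra.
Qed.

(** * Reducing the supremum to countably many times *)

Lemma right_gap (R : realType) (a : int -> R) (s : R) (F : seq int) :
  exists2 e, 0 < e & forall j, j \in F -> s < a j -> s + e <= a j.
Proof.
elim: F => [|j F [e e0 eF]]; first by exists 1.
have [sj|js] := ltP s (a j); last first.
  exists e => // i; rewrite inE => /predU1P[->|/eF//].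
  by move=> /(le_lt_trans js); rewrite ltxx.
exists (Num.min e (a j - s)); first by rewrite lt_min e0 subr_gt0.
move=> i; rewrite inE => /predU1P[->|iF] si.
  by rewrite -lerBrDl ge_min lexx orbT.
by apply: le_trans (eF _ iF si); rewrite lerD2l ge_min lexx.
Qed.

(** A finite total means finitely many arrivals in [(0, t]]; those after [s] then keep a positive
    distance from [s]. *)
Lemma arrived_right_continuous (R : realType) (a : int -> R) (s t : R) :
  (\esum_(j in [set: int]) ((arrived a t j)%:R : R)%:E < +oo)%E ->
  exists2 e, 0 < e & forall s', s <= s' < s + e -> s' <= t ->
    forall j, arrived a s' j = arrived a s j.
Proof.
move=> tfin.
have fint : finite_set [set j | arrived a t j].
  apply: contrapT => inf.
  have [[r| |] rE] : exists r, r = \esum_(j in [set: int])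
    ((arrived a t j)%:R : R)%:E by eexists.
  - have [F Ft rF] := infinite_set_fset (Num.truncn r).+1 inf.
    have := esum_count_ge R (arrived a t) (fset_uniq F).
    rewrite -rE (_ : count _ _ = #|` F|) ?lee_fin; last first.
      by apply/eqP; rewrite -all_count; apply/allP => j jF; exact: Ft.
    move=> Fr; move: rF; apply/negP; rewrite -leqNgt.
    rewrite -(@natrK R #|` F|); exact: le_truncn.
  - by move: tfin; rewrite -rE ltxx.
  - have := esum_count_ge R (arrived a t) (isT : uniq [::]).
    by rewrite -rE.
have [e e0 eF] := right_gap a s (fset_set [set j | arrived a t j]).
exists e => // s' /andP[ss' s'e] s't j; rewrite /arrived.
case: (ltP 0 (a j)) => //= aj0.
apply/idP/idP => [as'|/le_trans]; last exact.
rewrite leNgt; apply/negP => sa.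
have : s + e <= a j.
  apply: eF => //; rewrite in_fset_set// inE/= /arrived aj0.
  exact: le_trans s't.
by move=> /(lt_le_trans s'e); rewrite ltNge as'.
Qed.

(** An enumeration of the rationals in [[0, t]] together with [t], which is the default both for
    codes of nothing and for rationals outside the interval. *)
Definition grid (R : realType) (t : R) (n : nat) : R :=
  if choice.unpickle n is Some q then
    if 0 <= (ratr q : R) <= t then ratr q else t
  else t.

Lemma grid_itv (R : realType) (t : R) n : 0 <= t -> 0 <= grid t n <= t.
Proof.
move=> t0; rewrite /grid.
case: (choice.unpickle n) => [q|]; last by rewrite t0 lexx.
by case: ifP => // _; rewrite t0 lexx.
Qed.

(** Being constant just to the right of each [s < t], [D] takes the value [D s] at a rational time
    too; the endpoint [t] belongs to the grid. *)
Lemma ereal_sup_grid (R : realType) (D : R -> \bar R) (t : R) : 0 <= t ->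
  (forall s, 0 <= s < t -> exists2 e, 0 < e &
    forall s', s <= s' < s + e -> s' <= t -> D s' = D s) ->
  ereal_sup [set D s | s in [set s : R | 0 <= s <= t]] =
  ereal_sup (range (fun n => D (grid t n))).
Proof.
move=> t0 Dr; apply/eqP; rewrite eq_le; apply/andP; split; last first.
  apply: ge_ereal_sup => _ [n _ <-]; apply: ereal_sup_ubound.
  by exists (grid t n) => //=; exact: grid_itv.
apply: ge_ereal_sup => _ [s /= /andP[s0 st] <-]; apply: ereal_sup_ubound.
move: st; rewrite le_eqVlt => /predU1P[->|st].
  (* The rational -1 lies outside [[0, t]], so its code yields the default [t]. *)
  exists (choice.pickle (-1 : rat)) => //; rewrite /grid choice.pickleK rmorphN1.
  by rewrite oppr_ge0 ler10.
have [e e0 De] : exists2 e, 0 < e &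
    forall s', s <= s' < s + e -> s' <= t -> D s' = D s.
  by apply: Dr; rewrite s0.
have [q] : exists q, ratr q \in `]s, Num.min t (s + e)[.
  by apply: rat_in_itvoo; rewrite lt_min st ltrDl.
rewrite in_itv/= lt_min => /and3P[sq qt qe].
exists (choice.pickle q) => //.
rewrite /grid choice.pickleK (le_trans s0 (ltW sq)) (ltW qt)/=.
by apply: De; rewrite ?(ltW sq) ?(ltW qt).
Qed.

(** * Measurability of arrivals and workloads *)

Section measurability.
Context (d : measure_display) (T : measurableType d) (R : realType)
  (P : probability T R).

Lemma measurable_fun_ereal_sup_range (f : (T -> \bar R)^nat) :
  (forall n, measurable_fun [set: T] (f n)) ->
  measurable_fun [set: T] (fun w => ereal_sup (range (fun n => f n w))).
Proof.
move=> mf; have := measurable_fun_esups mf 0%N.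
apply: eq_measurable_fun => w _; rewrite /esups/= /sdrop.
by congr (ereal_sup (_ @` _)); apply/seteqP; split.
Qed.

Lemma measurable_arrivals (xi : int -> {RV P >-> R}) (U : {RV P >-> R}) (t : R) :
  measurable_fun [set: T] (arrivals (fun j => xi j : T -> R) U t).
Proof.
pose f n w : \bar R := (\sum_(j <- window 0 n)
  (\1_(`]0, t]%classic : set R) (j%:~R + xi j w + U w)))%:E.
(* Every finite set of customers lies in a window around 0, so the total is the supremum of the
   countably many window counts. *)
rewrite (_ : arrivals _ _ _ = fun w => ereal_sup (range (fun n => f n w))).
  apply: measurable_fun_ereal_sup_range => n; apply/measurable_EFinP.
  apply: measurable_sum => j.
  apply: (measurableT_comp (measurable_indic _)) => //.
  by do 2 ?apply: measurable_funD.
apply/funext => w; rewrite arrivals_esum.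
pose a j := j%:~R + xi j w + U w.
have fE n : f n w = (count (arrived a t) (window 0 n))%:R%:E.
  rewrite /f -sum_pred_count; congr (_%:E); apply: eq_bigr => j _.
  by rewrite indicE mem_setE in_itv.
apply/eqP; rewrite eq_le; apply/andP; split.
  apply: esum_count_le => s us; have [n sn] := sub_window 0 s.
  apply: (@le_trans _ _ (f n w)); last by apply: ereal_sup_ubound; exists n.
  by rewrite fE lee_fin ler_nat; exact: count_sub.
apply: ge_ereal_sup => _ [n _ <-]; rewrite fE.
exact: esum_count_ge (window_uniq _ _).
Qed.

Lemma measurable_Lambda (V : nat -> {RV P >-> R}) (N : R -> T -> \bar R) (t : R) :
  (forall i w, 0 <= V i w) -> measurable_fun [set: T] (N t) ->
  measurable_fun [set: T] (Lambda (fun i => V i : T -> R) N t).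
Proof.
move=> V0 mN.
rewrite (_ : Lambda _ _ _ = fun w => (\sum_(0 <= i <oo | i \in predT)
    if (i.+1%:R%:E <= N t w)%E then (V i w)%:E else 0)%E); last first.
  by apply/funext => w; rewrite /Lambda eseries_mkcond.
apply: ge0_emeasurable_sum => i; first by move=> w _ _; case: ifP; rewrite ?lee_fin.
move=> _; apply: measurable_fun_ifT => //; last exact/measurable_EFinP.
by apply: measurable_fun_lee => //; exact: measurable_cst.
Qed.

Lemma measurable_Lambda' (V : nat -> {RV P >-> R}) (t : R) :
  measurable_fun [set: T] (Lambda' (fun i => V i : T -> R) t).
Proof. exact: measurable_sum. Qed.

Lemma measurable_gap (V : nat -> {RV P >-> R}) (N : R -> T -> \bar R) (t : R) :
  (forall i w, 0 <= V i w) -> measurable_fun [set: T] (N t) ->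
  measurable_fun [set: T] (fun w => `|Lambda (fun i => V i : T -> R) N t w -
    (Lambda' (fun i => V i : T -> R) t w)%:E|)%E.
Proof.
move=> V0 mN; apply: measurableT_comp => //.
apply: emeasurable_funB; first exact: measurable_Lambda.
apply/measurable_EFinP; exact: measurable_Lambda'.
Qed.

End measurability.

(** * Exponential tail for a count of independent events *)

Section independent_count.
Context (d : measure_display) (T : measurableType d) (R : realType)
  (P : probability T R) (I : choiceType) (X : I -> {RV P >-> R})
  (b : I -> pred R) (q : I -> R).
Hypotheses (indepX : mutually_independent X)
  (mb : forall j, measurable [set x | b j x])
  (Pb : forall j, P (X j @^-1` [set x | b j x]) = (q j)%:E).

Let atleast m s := [set w | (m <= count (fun j => b j (X j w)) s)%N].

Let atleast0 s : atleast 0 s = setT. Proof. exact/seteqP. Qed.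

Let atleast_cons m j s : atleast m.+1 (j :: s) =
  atleast m.+1 s `|` (X j @^-1` [set x | b j x] `&` atleast m s).
Proof.
apply/seteqP; split => w; rewrite /atleast /=.
  by case: (b j _) => /=; [rewrite add1n ltnS; right|rewrite add0n; left].
by case=> [/leq_trans|[-> h]]; [apply; rewrite leq_addl|rewrite add1n ltnS].
Qed.

Let mX j : measurable (X j @^-1` [set x | b j x]).
Proof. exact: measurable_funPTI. Qed.

Lemma measurable_atleast m s :
  measurable [set w | (m <= count (fun j => b j (X j w)) s)%N].
Proof.
elim: s m => [|j s IH] [|m]; rewrite -/(atleast _ _) ?atleast0//.
  by rewrite (_ : atleast _ _ = set0)// ; apply/seteqP; split.
by rewrite atleast_cons; apply: measurableU; [|apply: measurableI => //]; exact: IH.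
Qed.

Let q0 j : 0 <= q j. Proof. by rewrite -lee_fin -Pb. Qed.

Let prod_ge1 s : 1 <= \prod_(j <- s) (1 + 2 * q j).
Proof.
elim: s => [|j s IH]; first by rewrite big_nil.
rewrite big_cons -[leLHS]mulr1 ler_pM// lerDl; exact: mulr_ge0.
Qed.

Let cap (J : {fset I}) := \bigcap_(j in [set` J]) (X j @^-1` [set x | b j x]).

Let mcap J : measurable (cap J).
Proof. by apply: fin_bigcap_measurable => //; exact: finite_fset. Qed.

Let Pcap J : P (cap J) = (\prod_(j <- J) q j)%:E.
Proof.
rewrite indepX// -prodEFin; apply: eq_bigr => j _; exact: Pb.
Qed.

(* The claim is relative to the events indexed by J so that the induction can
   condition on a further event without appealing to independence of
   counts. *)
Let count_tail_cap (s : seq I) (J : {fset I}) m :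
  uniq s -> (forall j, j \in s -> j \notin J) ->
  (P (cap J `&` atleast m s) <=
   (\prod_(j <- J) q j * (2 ^- m * \prod_(j <- s) (1 + 2 * q j)))%:E)%E.
Proof.
have qJ0 (K : {fset I}) : 0 <= \prod_(j <- K) q j by apply: prodr_ge0 => j _.
elim: s J m => [|j s IH] J [|m] us sJ.
- by rewrite atleast0 setIT Pcap expr0 invr1 big_nil !mulr1.
- rewrite (_ : atleast _ _ = set0); last by apply/seteqP; split.
  rewrite setI0 measure0 lee_fin big_nil mulr1.
  by apply: mulr_ge0; rewrite ?qJ0// invr_ge0 exprn_ge0.
- by rewrite atleast0 setIT Pcap expr0 invr1 mul1r lee_fin ler_peMr// qJ0.
rewrite atleast_cons setIUr.
have /andP[js us'] := us.
have jJ : j \notin J by apply: sJ; rewrite mem_head.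
have capU : cap J `&` (X j @^-1` [set x | b j x] `&` atleast m s) =
    cap (j |` J)%fset `&` atleast m s.
  rewrite setIA; congr (_ `&` _); apply/seteqP; split => w.
    by case=> cJ Xj i /=; rewrite !inE => /predU1P[->|/cJ].
  move=> c; split; last by apply: (c j); rewrite /= !inE eqxx.
  by move=> i /= iJ; apply: (c i); rewrite /= !inE iJ orbT.
rewrite capU.
apply: le_trans (measureU2 P _ _) _.
- by apply: measurableI => //; exact: measurable_atleast.
- by apply: measurableI => //; exact: measurable_atleast.
apply: le_trans (leeD (IH J m.+1 us' _) (IH (j |` J)%fset m us' _)) _.
- by move=> i si; apply: sJ; rewrite inE si orbT.
- move=> i si; rewrite !inE negb_or sJ ?andbT ?inE ?si ?orbT//.
  by apply: contraNneq js => <-.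
(* The two bounds add up because [2 ^- m.+1 + q j * 2 ^- m = 2 ^- m.+1 * (1 + 2 * q j)]. *)
rewrite -EFinD lee_fin big_fsetU1//= big_cons.
rewrite exprSr invfM le_eqVlt; apply/orP; left; apply/eqP.
have -> : (2 ^+ m)^-1 = 2 * ((2 ^+ m)^-1 / 2) :> R by field; rewrite expf_neq0.
field. by rewrite expf_neq0.
Qed.

(** The case of empty [J], with [1 + 2 * q j <= expR (2 * q j)]. The list enters the bound only
    through the sum of the probabilities, which makes it uniform over windows. *)
Lemma count_tail (s : seq I) m : uniq s ->
  (P [set w | (m <= count (fun j => b j (X j w)) s)%N] <=
   (2 ^- m * expR (2 * \sum_(j <- s) q j))%:E)%E.
Proof.
move=> us; have := @count_tail_cap s fset0 m us (fun _ _ => isT).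
rewrite (_ : cap fset0 = setT); last by apply/seteqP; split.
rewrite setTI big_seq_fset0 mul1r => /le_trans; apply.
rewrite lee_fin ler_wpM2l ?invr_ge0 ?exprn_ge0// mulr_sumr expR_sum.
apply: ler_prod => j _; rewrite expR_ge1Dx andbT addr_ge0// mulr_ge0//.
Qed.

End independent_count.

(** * Tail of the number of displaced customers *)

Lemma count_iota_le (R : realType) (z : R) n : 0 <= z ->
  (count (fun i => i.+1%:R <= z) (iota 0 n))%:R <= z.
Proof.
move=> z0; apply: (@le_trans _ _ (Num.truncn z)%:R); last first.
  by rewrite truncn_le.
rewrite ler_nat -[leqRHS](size_iota 0) -size_filter; apply: uniq_leq_size.
  by rewrite filter_uniq// iota_uniq.
by move=> i; rewrite mem_filter !mem_iota/= -truncn_gt_nat => /andP[].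
Qed.

(** The right ray holds the distances [0, 1, ...] and contributes at most [2 + y]; the left ray
    starts at distance 1 and contributes at most [1 + y]. *)
Lemma count_displaced_le (R : realType) (y : R) k n : 0 <= y ->
  (count (fun j => `|j - k|%:~R <= 1 + y) (window k n))%:R <= 3 + 2 * y.
Proof.
move=> y0; rewrite count_cat !count_map natrD.
have := @count_iota_le R (2 + y) n; have := @count_iota_le R (1 + y) n.
set c1 := count _ _; set c2 := count _ _; set c3 := count _ _; set c4 := count _ _.
have -> : c3 = c2.
  apply: eq_count => i /=; rewrite (_ : `|k + i - k| = i%:Z); last lia.
  by rewrite -pmulrn -natr1; apply/idP/idP; lra.
have -> : c4 = c1.
  by apply: eq_count => i /=; rewrite (_ : `|k - i.+1%:Z - k| = i.+1%:Z)//; lia.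
move=> h1 h2; have := h1 ltac:(lra); have := h2 ltac:(lra); lra.
Qed.

Section displaced_tail.
Context (d : measure_display) (T : measurableType d) (R : realType)
  (P : probability T R) (xi : int -> {RV P >-> R}).
Hypotheses (iid_xi : iid xi) (xi1 : ('E_P[fun w => `|xi 0 w|%R] < +oo)%E).

Let far k : int -> pred R := fun j x => `|j - k|%:~R <= 1 + `|x|.

Let mfar k j : measurable [set x | far k j x].
Proof.
rewrite -[X in measurable X]setTI; apply: measurable_fun_le => //.
exact: measurable_funD.
Qed.

Definition overcrowded (m : nat) (k : int) :=
  \bigcup_n [set w | (m <= count (displaced (xi ^~ w) k) (window k n))%N].

Let mcount m k n : measurable
  [set w | (m <= count (displaced (xi ^~ w) k) (window k n))%N].
Proof. exact: (measurable_atleast xi (mfar k)). Qed.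

Lemma measurable_overcrowded m k : measurable (overcrowded m k).
Proof. exact: bigcup_measurable. Qed.

(** Each [xi j] may be replaced by [xi 0], which has the same law. The sum of probabilities becomes
    the expectation of a count driven by the single variable [xi 0], bounded pointwise by
    [3 + 2 * |xi 0|]. *)
Let sum_far k n :
  \sum_(j <- window k n) fine (P (xi j @^-1` [set x | far k j x])) <=
  3 + 2 * fine 'E_P[fun w => `|xi 0 w|%R].
Proof.
rewrite -lee_fin -sumEFin EFinD EFinM fineK; last first.
  by rewrite ge0_fin_numE//; apply: expectation_ge0.
pose A j := xi 0 @^-1` [set x | far k j x].
have mA j : measurable (A j) by exact: measurable_funPTI.
rewrite (eq_bigr (fun j => \int[P]_w (\1_(A j) w)%:E)%E); last first.
  move=> j _; rewrite fineK ?fin_num_measure//; last exact: measurable_funPTI.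
  by rewrite integral_indic// setIT; exact: iid_xi.2.
rewrite -ge0_integral_sum//; last first.
  by move=> j; apply/measurable_EFinP; exact: measurable_indic.
have mabs : measurable_fun [set: T] (fun w => `|xi 0 w|%:E).
  by apply/measurable_EFinP; exact: measurableT_comp.
rewrite -(expectation_cst P 3) expectation.unlock.
have m3 : measurable_fun [set: T] (fun x => (cst 3 x : R)%:E).
  by apply/measurable_EFinP; exact: measurable_cst.
have m2 : measurable_fun [set: T] (fun w => 2 * `|xi 0 w|%:E)%E.
  exact: measurable_funeM.
rewrite -ge0_integralZl// -ge0_integralD//; last by move=> w _; rewrite lee_fin.
apply: ge0_le_integral => //.
- by move=> w _; apply: sume_ge0.
- by apply: emeasurable_sum => j; apply/measurable_EFinP; exact: measurable_indic.
- exact: emeasurable_funD.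
move=> w _; rewrite sumEFin -EFinM -EFinD lee_fin.
apply: le_trans (count_displaced_le k n (normr_ge0 (xi 0 w))).
rewrite -sum_pred_count le_eqVlt; apply/orP; left; apply/eqP.
by apply: eq_bigr => j _; rewrite indicE /A /far; congr (nat_of_bool _)%:R;
  apply/idP/idP; rewrite inE.
Qed.

(** The window events increase with [n], so their tail bound, uniform in [n], passes to the union.
    The exponent is twice the bound of [sum_far]. *)
Lemma overcrowded_tail m k : (P (overcrowded m k) <=
  (2 ^- m * expR (6 + 4 * fine 'E_P[fun w => `|xi 0 w|%R]))%:E)%E.
Proof.
have nd : nondecreasing_seq
    (fun n => [set w | (m <= count (displaced (xi ^~ w) k) (window k n))%N]).
  move=> n n' nn'; apply/subsetPset => w /= /leq_trans; apply.
  apply: count_sub (window_uniq _ _) _ => j; rewrite !mem_window; lia.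
have cv := nondecreasing_cvg_mu (mu := P) (mcount m k) (measurable_overcrowded m k) nd.
rewrite -(cvg_lim (@ereal_hausdorff R) cv); apply: lime_le.
  by apply/cvg_ex; eexists; exact: cv.
apply: nearW => n /=.
have Pq j : P (xi j @^-1` [set x | far k j x]) =
    (fine (P (xi j @^-1` [set x | far k j x])))%:E.
  by rewrite fineK// fin_num_measure//; exact: measurable_funPTI.
apply: le_trans (count_tail iid_xi.1 (mfar k) Pq m (window_uniq k n)) _.
rewrite lee_fin ler_wpM2l ?invr_ge0 ?exprn_ge0// ler_expR.
have := sum_far k n; lra.
Qed.

End displaced_tail.

(** * From convergence in probability to convergence in distribution *)

Section convergence_in_probability.
Context (d : measure_display) (T : measurableType d) (R : realType)
  (P : probability T R).

(** Pointwise, [|f (X w) - f 0|] is at most [e] where [|X w| <= del], and at most [2 * M] elsewhere;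
    integrate. *)
Let expectation_dist (X : {RV P >-> R}) (f : R -> R) (M e del eta : R) :
  continuous f -> (forall x, `|f x| <= M) -> 0 <= e ->
  (forall x, `|x| <= del -> `|f x - f 0| <= e) ->
  (P [set w | (del < `|X w|)%R] <= eta%:E)%E ->
  'E_P[f \o X]%E \is a fin_num /\
  `|fine 'E_P[f \o X]%E - f 0| <= e + 2 * M * eta.
Proof.
move=> cf fM e0 fe Peta.
have M0 : 0 <= M := le_trans (normr_ge0 _) (fM 0).
have mfX : measurable_fun [set: T] (f \o X).
  by apply: measurableT_comp => //; exact: continuous_measurable_fun.
have icst k := finite_measure_integrable_cst P k (@measurableT _ T).
have ifX : P.-integrable [set: T] (EFin \o (f \o X)).
  apply: (le_integrable _ _ _ (icst M)) => //; first exact/measurable_EFinP.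
  by move=> w _ /=; rewrite lee_fin (ger0_norm M0).
have fin : 'E_P[f \o X]%E \is a fin_num.
  by rewrite expectation.unlock; exact: integrable_fin_num ifX.
split=> //.
set A := [set w | _] in Peta.
have mA : measurable A.
  have mabs : measurable_fun [set: T] (fun w => `|X w|) by exact: measurableT_comp.
  rewrite -[A]setTI; exact: (measurable_fun_ltr (measurable_cst del) mabs
    measurableT (Y := [set true])).
have m1 : measurable_fun [set: T] (fun w => (\1_A w : R)%:E).
  by apply/measurable_EFinP; exact: measurable_indic.
have mdiff : measurable_fun [set: T] (fun w => (f (X w))%:E - (f 0)%:E)%E.
  by apply: emeasurable_funB => //; apply/measurable_EFinP.
rewrite -lee_fin; have -> : (`|fine 'E_P[f \o X] - f 0|%:E =
    `|\int[P]_w ((f (X w))%:E - (f 0)%:E)|)%E.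
  rewrite (integralB_EFin measurableT ifX (icst (f 0))).
  have := expectation_cst P (f 0); rewrite expectation.unlock => ->.
  by rewrite -[in RHS](fineK (integrable_fin_num measurableT ifX)).
apply: le_trans (le_abse_integral _ _ _) _ => //.
have c0 : 0 <= 2 * M by rewrite mulr_ge0.
have mb : measurable_fun [set: T] (fun w => (2 * M)%:E * (\1_A w)%:E)%E.
  exact: measurable_funeM.
apply: (@le_trans _ _ (\int[P]_w ((cst e w)%:E + (2 * M)%:E * (\1_A w)%:E))%E).
  apply: ge0_le_integral => //.
  - exact: measurableT_comp.
  - by apply: emeasurable_funD => //; apply/measurable_EFinP; exact: measurable_cst.
  move=> w _; rewrite -EFinB abse_EFin -EFinM -EFinD lee_fin indicE.
  have [Aw|Aw] := boolP (w \in A).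
    rewrite mulr1; apply: le_trans (ler_normB _ _) _.
    by have := fM (X w); have := fM 0; rewrite /cst; lra.
  rewrite mulr0 addr0; apply: fe; rewrite leNgt; apply: contra Aw => ?.
  by rewrite inE.
rewrite ge0_integralD//.
- rewrite ge0_integralZl// integral_indic// setIT.
  have := expectation_cst P e; rewrite expectation.unlock => ->.
  rewrite EFinD [in leRHS]EFinM; apply: leeD => //.
  by apply: lee_pmul => //; rewrite lee_fin.
- by apply/measurable_EFinP; exact: measurable_cst.
- by move=> w _; rewrite -EFinM lee_fin mulr_ge0.
Qed.

Lemma cvg_prob_cvg_in_distribution (Y : R -> {RV P >-> R}) :
  (forall del eta, 0 < del -> 0 < eta -> \forall t \near +oo,
    (P [set w | (del < `|Y t w|)%R] <= eta%:E)%E) ->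
  cvg_in_distribution Y (cst 0).
Proof.
move=> Y0 f cf [M fM].
rewrite (expectation_cst P (f 0)).
have M0 : 0 <= M := le_trans (normr_ge0 _) (fM 0).
have dist e : 0 < e -> \forall t \near +oo, 'E_P[f \o Y t]%E \is a fin_num /\
    `|fine 'E_P[f \o Y t]%E - f 0| <= e.
  move=> e0; have e2 : 0 < e / 2 by rewrite divr_gt0.
  have /cvgrPdist_le/(_ _ e2)[del /= del0 fdel] := cf 0.
  (* This probability makes the contribution of large values at most [e / 2]; the added 1 keeps the
     denominator positive when [M = 0]. *)
  have eta0 : 0 < e / 2 / (2 * M + 1) by rewrite divr_gt0// ltr_wpDl// mulr_ge0.
  near=> t.
  (* Continuity controls [f] on the open ball of radius [del], hence on the closed one of radius
     [del / 2]. *)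
  have [||] := @expectation_dist (Y t) f M (e / 2) (del / 2)
    (e / 2 / (2 * M + 1)) cf fM (ltW e2).
  - move=> x xd; rewrite distrC; apply: fdel => /=; rewrite sub0r normrN.
    by apply: le_lt_trans xd _; rewrite ltr_pdivrMr// ltr_pMr// ltr1n.
  - by near: t; apply: Y0 => //; rewrite divr_gt0.
  move=> ? h; split=> //; apply: le_trans h _.
  rewrite [leRHS]splitr lerD2l mulrA ler_pdivrMr; last by rewrite ltr_wpDl// mulr_ge0.
  by rewrite mulrC ler_pM2l// lerDl.
apply/fine_cvgP; split.
  by have := dist _ ltr01; apply: filterS => t [].
apply/cvgrPdist_le => e /dist; apply: filterS => t [_].
by rewrite distrC.
Unshelve. all: end_near. Qed.

End convergence_in_probability.

(** * Tail of the largest service requirement *)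

Section max_tail.
Context (d : measure_display) (T : measurableType d) (R : realType)
  (P : probability T R) (V : nat -> {RV P >-> R}) (p : R).
Hypotheses (idV : identically_distributed V) (V0 : forall i w, 0 <= V i w)
  (p0 : 0 <= p).

Definition some_exceeds (n : nat) (v : R) :=
  \big[setU/set0]_(i < n) [set w | v < V i w].

Let mexceeds i v : measurable [set w | v < V i w].
Proof.
rewrite (_ : [set _ | _] = V i @^-1` `]v, +oo[%classic); first exact: measurable_funPTI.
by apply/seteqP; split => w /=; rewrite in_itv/= andbT.
Qed.

Lemma measurable_some_exceeds n v : measurable (some_exceeds n v).
Proof. exact: bigsetU_measurable. Qed.

(** A union bound over the [n] requirements, then equality of laws and Markov's inequality for the
    [p]-th power. *)
Lemma some_exceeds_tail n (v : R) : 0 < v ->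
  ('E_P[fun w => (V 0%N w `^ p)%R] < +oo)%E ->
  (P (some_exceeds n v) <=
   (n%:R * (fine 'E_P[fun w => (V 0%N w `^ p)%R] / v `^ p))%:E)%E.
Proof.
move=> v0 Vp; rewrite /some_exceeds.
apply: le_trans (Boole_inequality P (A := fun i => [set w | v < V i w]) _) _ => //.
suff Vi i : (P [set w | (v < V i w)%R] <=
    (fine 'E_P[fun w => (V 0%N w `^ p)%R] / v `^ p)%:E)%E.
  apply: (@le_trans _ _ (\sum_(i < n)
      (fine 'E_P[fun w => (V 0%N w `^ p)%R] / v `^ p)%:E)%E).
    by apply: lee_sum => i _; exact: Vi.
  by rewrite sumEFin sumr_const card_ord mulr_natl.
have -> : P [set w | v < V i w] = P [set w | v < V 0%N w].
  have setE j : [set w | v < V j w] = V j @^-1` `]v, +oo[%classic.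
    by apply/seteqP; split => w /=; rewrite in_itv/= andbT.
  by rewrite !setE; exact: idV.
rewrite EFinM fineK; last first.
  by rewrite ge0_fin_numE//; apply: expectation_ge0 => w; exact: powR_ge0.
rewrite lee_pdivlMr ?powR_gt0// muleC.
have f0 (r : R) : 0 <= r -> 0 <= r `^ p by move=> _; exact: powR_ge0.
have fnd : {in Num.nneg &, {homo (fun r : R => r `^ p) : x y / x <= y}}.
  by move=> x y x0 y0; exact: ge0_ler_powR.
have := markov (V 0%N) v0 (measurable_powR p) f0 fnd.
rewrite (_ : (_ \o _) \o _ = fun w => V 0%N w `^ p); last first.
  by apply/funext => w /=; rewrite ger0_norm.
apply: le_trans; apply: lee_pmul => //; first by rewrite lee_fin powR_ge0.
apply: le_measure; rewrite ?inE//; last first.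
  by move=> w /= /ltW vw; rewrite lee_fin ger0_norm.
rewrite -[X in measurable X]setTI; apply: emeasurable_fun_c_infty => //.
by apply/measurable_EFinP; exact: measurableT_comp.
Qed.

End max_tail.

(** * Elementary asymptotics *)

Lemma bernoulli_ineq (R : realFieldType) (h : R) n : 0 <= h ->
  1 + n%:R * h <= (1 + h) ^+ n.
Proof.
move=> h0; elim: n => [|n IH]; first by rewrite expr0 mul0r addr0.
rewrite exprS; apply: (@le_trans _ _ ((1 + h) * (1 + n%:R * h))); last first.
  by rewrite ler_wpM2l// addr_ge0.
have : 0 <= n%:R * h * h by rewrite !mulr_ge0.
rewrite -natr1; lra.
Qed.

(** Write [z = s * s]: Bernoulli's inequality bounds [n%:R * s ^+ n], and the remaining factor
    [s ^+ n] tends to 0. *)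
Lemma natr_expr_small (R : realType) (z e : R) : 0 < z < 1 -> 0 < e ->
  exists N, forall n, (N <= n)%N -> n%:R * z ^+ n <= e.
Proof.
move=> /andP[z0 z1] e0; pose s := Num.sqrt z.
have s0 : 0 < s by rewrite sqrtr_gt0.
have s1 : s < 1 by rewrite -sqrtr1 ltr_sqrt.
have ss : s * s = z by rewrite -expr2 sqr_sqrtr// ltW.
pose h := s^-1 - 1.
have h0 : 0 < h by rewrite subr_gt0 invf_gt1.
have hs : 1 + h = s^-1 by rewrite addrC subrK.
have nsn n : n%:R * s ^+ n <= h^-1.
  have := bernoulli_ineq n (ltW h0); rewrite hs exprVn => b.
  rewrite -ler_pdivlMr ?exprn_gt0// -[leRHS]mulrC -ler_pdivrMr ?invr_gt0// invrK.
  by apply: le_trans b; rewrite lerDr.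
have eh : 0 < e * h by exact: mulr_gt0.
have s1' : `|s| < 1 by rewrite gtr0_norm.
have /cvgrPdist_le/(_ _ eh)[N _ sN] := cvg_expr s1'.
exists N => n Nn; have := sN n Nn.
rewrite /= sub0r normrN ger0_norm ?exprn_ge0 ?(ltW s0)// => sn.
rewrite -ss exprMn mulrA.
apply: (@le_trans _ _ (h^-1 * (e * h))).
  by apply: ler_pM => //; rewrite ?mulr_ge0 ?exprn_ge0 ?(ltW s0).
by rewrite mulrC mulfK ?gt_eqF.
Qed.

(** The left side is the [p]-th power of [n * z ^ n] with [z = 2 ^ (1/p - 1/2)], and [p > 2] gives
    [z < 1]. Here [n] stands for the logarithm of time in base 2. *)
Lemma powR_geometric_small (R : realType) (p e : R) : 2 < p -> 0 < e ->
  exists N, forall n, (N <= n)%N ->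
    2 ^+ n * (n%:R / Num.sqrt 2 ^+ n) `^ p <= e.
Proof.
move=> p2 e0; have p0 : 0 < p by apply: lt_trans p2.
pose z : R := 2 `^ (p^-1) / Num.sqrt 2.
have z0 : 0 < z by rewrite divr_gt0 ?powR_gt0 ?sqrtr_gt0.
have z1 : z < 1.
  rewrite ltr_pdivrMr ?sqrtr_gt0// mul1r -powR12_sqrt//.
  rewrite /powR pnatr_eq0/= ltr_expR ltr_pM2r ?ln_gt0 ?ltr1n//.
  by rewrite ltf_pV2 ?posrE.
have ep : 0 < e `^ p^-1 by exact: powR_gt0.
have [|N zN] := @natr_expr_small R z _ _ ep; first by rewrite z0.
exists N => n /zN; rewrite /z expr_div_n => h.
have s2 : 0 < Num.sqrt 2 ^+ n :> R by rewrite exprn_gt0// sqrtr_gt0.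
have -> : 2 ^+ n = ((2 `^ p^-1) ^+ n) `^ p :> R.
  rewrite -(powR_mulrn n (powR_ge0 _ _)) -!powRrM mulrCA mulVf ?gt_eqF// mulr1.
  by rewrite powR_mulrn.
rewrite -powRM ?exprn_ge0 ?powR_ge0 ?divr_ge0// ?(ltW s2)//.
have -> : e = (e `^ p^-1) `^ p by rewrite -powRrM mulVf ?gt_eqF// powRr1// ltW.
apply: ge0_ler_powR; rewrite ?nnegrE ?powR_ge0 ?(ltW p0)//.
by apply: le_trans h; rewrite mulrCA.
Qed.

(** * Bounding the scaled supremum *)

Section overcrowding.
Context (d : measure_display) (T : measurableType d) (R : realType)
  (P : probability T R) (xi : int -> {RV P >-> R}) (U : {RV P >-> R})
  (V : nat -> {RV P >-> R}).
Hypotheses (iid_xi : iid xi) (xi1 : ('E_P[fun w => `|xi 0%R w|%R] < +oo)%E)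
  (uniformU : uniform01 U) (V0 : forall i w, 0 <= V i w).

Let N := arrivals (fun j => xi j : T -> R) U.
Let c := expR (6 + 4 * fine 'E_P[fun w => `|xi 0%R w|%R]%E).
Let Vf := fun i => V i : T -> R.

(** Off this event at most [m] customers are displaced at each integer from 0 to [n], which covers
    both 0 and the integer part of any time considered. *)
Definition overcrowded_before (n m : nat) :=
  \big[setU/set0]_(k < n.+1) overcrowded xi m.+1 k%:Z.

Lemma measurable_overcrowded_before n m : measurable (overcrowded_before n m).
Proof. by apply: bigsetU_measurable => k _; exact: measurable_overcrowded. Qed.

Lemma overcrowded_before_tail n m :
  (P (overcrowded_before n m) <= (n.+1%:R * (2 ^- m.+1 * c))%:E)%E.
Proof.
rewrite /overcrowded_before.
apply: le_trans (Boole_inequality P (A := fun k => overcrowded xi m.+1 k%:Z) _) _.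
  by move=> k _; exact: measurable_overcrowded.
apply: (@le_trans _ _ (\sum_(k < n.+1) (2 ^- m.+1 * c)%:E)%E).
  by apply: lee_sum => k _; exact: overcrowded_tail.
by rewrite sumEFin sumr_const card_ord mulr_natl.
Qed.

Lemma arrivals_bounds s n m w : 0 <= U w <= 1 -> 0 <= s ->
  (Num.truncn s <= n)%N -> ~ overcrowded_before n m w ->
  ((Num.truncn s - 2 * m)%:R%:E <= N s w)%E /\
  (N s w <= (Num.truncn s + 2 * m)%:R%:E)%E.
Proof.
move=> /andP[U0 U1] s0 sn notcrowd.
pose a j := j%:~R + xi j w + U w.
have xa j : j%:~R + xi j w <= a j <= j%:~R + xi j w + 1.
  by rewrite lerDl U0 lerD2l.
have few e : e = 0 \/ e = (Num.truncn s)%:Z ->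
    forall n', (count (displaced (xi ^~ w) e) (window e n') <= m)%N.
  move=> e0s n'; rewrite leqNgt; apply/negP => mc; apply: notcrowd.
  have [k kn ek] : exists2 k, (k < n.+1)%N & e = k%:Z.
    by case: e0s => ->; [exists 0%N|exists (Num.truncn s)].
  rewrite /overcrowded_before -(bigcup_mkord n.+1 (fun k => overcrowded xi m.+1 k%:Z)).
  by exists k => //; exists n' => //; rewrite -ek.
rewrite /N arrivals_esum; split.
  have [F uF aF] := arrived_ge xa s0 few.
  by apply: le_trans (esum_count_ge _ _ uF); rewrite lee_fin ler_nat.
apply: esum_count_le => F uF; rewrite lee_fin ler_nat.
exact: (arrived_le xa s0 few uF).
Qed.

Let gap s w := `|Lambda Vf N s w - (Lambda' Vf s w)%:E|%E.

Lemma sup_gap_le t m v w : 0 <= t -> 0 <= U w <= 1 ->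
  ~ overcrowded_before (Num.truncn t) m w -> 0 <= v ->
  (forall i, (i < Num.truncn t + 2 * m)%N -> V i w <= v) ->
  (ereal_sup [set gap s w | s in [set s : R | (0 <= s <= t)%R]] <=
    ((2 * m)%:R * v)%:E)%E.
Proof.
move=> t0 U01 notcrowd v0 Vv; apply: ge_ereal_sup => _ [s /= /andP[s0 st] <-].
have tst := le_truncn st.
have [lN Nh] := arrivals_bounds U01 s0 tst notcrowd.
apply: Lambda_diff_le => //; first by move=> i; exact: V0.
by move=> i ik; apply: Vv; exact: leq_trans ik (leq_add tst _).
Qed.

Lemma sup_gap_ge0 t w : 0 <= t ->
  (0 <= ereal_sup [set gap s w | s in [set s : R | (0 <= s <= t)%R]])%E.
Proof.
move=> t0; apply: (@le_trans _ _ (gap 0 w)); first exact: abse_ge0.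
by apply: ereal_sup_ubound; exists 0 => //=; rewrite lexx.
Qed.

Lemma sup_gap_grid t w : 0 <= t -> (N t w < +oo)%E ->
  ereal_sup [set gap s w | s in [set s : R | (0 <= s <= t)%R]] =
  ereal_sup (range (fun n => gap (grid t n) w)).
Proof.
move=> t0 Nt; apply: ereal_sup_grid => // s /andP[s0 st].
pose a j := j%:~R + xi j w + U w.
move: Nt; rewrite /N arrivals_esum => /(@arrived_right_continuous _ a s)[e e0 ae].
(* [Lambda'] jumps at the integers, so the interval must also stop before the next one. *)
pose e' := Num.min e ((Num.truncn s).+1%:R - s).
exists e'; first by rewrite lt_min e0 subr_gt0 truncnS_gt.
move=> s' /andP[ss' s'e] s't.
have [s's1 s's2] : s' < s + e /\ s' < (Num.truncn s).+1%:R.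
  split; apply: lt_le_trans s'e _; first by rewrite lerD2l ge_min lexx.
  by rewrite -lerBrDl ge_min lexx orbT.
have tE : Num.truncn s' = Num.truncn s.
  apply: truncn_def; rewrite s's2 andbT (le_trans _ ss')//.
  by rewrite truncn_le.
have NE : N s' w = N s w.
  rewrite /N !arrivals_esum; apply: eq_esum => j _.
  by rewrite (ae s')// ss'.
by rewrite /gap /Lambda /Lambda' NE tE.
Qed.

Lemma ae_uniform01 : {ae P, forall w, 0 <= U w <= 1}.
Proof.
exists (U @^-1` (~` `[0, 1]%classic)); split.
- by apply: measurable_funPTI; exact: measurableC.
- have := uniformU (measurableC (measurable_itv `[(0 : R), 1])).
  rewrite /distribution/= /pushforward => ->; rewrite /uniform_prob.
  apply: integral0_eq => x /= x01; rewrite /uniform_pdf.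
  by case: ifPn => // h; exfalso; apply: x01; rewrite in_itv.
- by move=> w /= Uw; rewrite in_itv.
Qed.

(** The tail bound tends to 0 as [m] grows, so the intersection over [m] is null. This is what makes
    the number of arrivals finite almost surely. *)
Lemma ae_not_overcrowded n :
  {ae P, forall w, exists m, ~ overcrowded_before n m w}.
Proof.
exists (\bigcap_m overcrowded_before n m); split.
- by apply: bigcap_measurableType => m _; exact: measurable_overcrowded_before.
- apply/eqP; rewrite eq_le measure_ge0 andbT; apply/lee_addgt0Pr => e e0.
  rewrite add0e.
  have half : `|2^-1 : R| < 1 by rewrite ger0_norm// invf_lt1// ltr1n.
  have /cvgrPdist_le/(_ _ e0)[m _ me] := cvg_geometric (n.+1%:R * c) half.
  have := me m.+1 (leqnSn _); rewrite /geometric/= sub0r normrN => h.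
  apply: (@le_trans _ _ (P (overcrowded_before n m))).
    apply: le_measure; rewrite ?inE; last exact: bigcap_inf.
    + by apply: bigcap_measurableType => *; exact: measurable_overcrowded_before.
    + exact: measurable_overcrowded_before.
  apply: le_trans (overcrowded_before_tail n m) _; rewrite lee_fin.
  apply: le_trans h; rewrite exprVn mulrAC -mulrA; exact: ler_norm.
- by move=> w /= h m _; apply: contrapT => ?; apply: h; exists m.
Qed.

(** The measurable version of the scaled supremum: only countably many times are used, and [fine]
    replaces infinite values by 0. *)
Definition scaled_sup_grid t w := fine ((Num.sqrt t)^-1%:E *
  ereal_sup (range (fun n => gap (grid t n) w)))%E.

Lemma measurable_scaled_sup_grid t : measurable_fun [set: T] (scaled_sup_grid t).
Proof.
apply: (measurableT_comp (fine_measurable measurableT)).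
apply: measurable_funeM; apply: measurable_fun_ereal_sup_range => n.
by apply: measurable_gap => //; exact: measurable_arrivals.
Qed.

Lemma scaled_sup_gridE t : 0 < t ->
  {ae P, forall w, (scaled_sup_grid t w)%:E = scaled_sup Vf N t w}.
Proof.
move=> t0; have t0' := ltW t0.
have := ae_uniform01; have := ae_not_overcrowded (Num.truncn t).
apply: filterS2 => w [m notcrowd] U01.
have [_ Nh] := arrivals_bounds U01 t0' (leqnn _) notcrowd.
rewrite /scaled_sup -/(gap _ _) sup_gap_grid//; last exact: le_lt_trans Nh (ltry _).
rewrite /scaled_sup_grid fineK// -sup_gap_grid//; last exact: le_lt_trans Nh (ltry _).
rewrite fin_numM// ge0_fin_numE.
  (* Any finite bound on the requirements involved will do here; their sum is one. *)
  apply: le_lt_trans (ltry _); apply: (@sup_gap_le t m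
    (\sum_(i < Num.truncn t + 2 * m) V i w)) => //; first exact: sumr_ge0.
  move=> i ik; rewrite (bigD1 (Ordinal ik))//= lerDl; exact: sumr_ge0.
exact: sup_gap_ge0.
Qed.

Variable p : R.
Hypotheses (idV : identically_distributed V) (p2 : 2 < p)
  (Vp : ('E_P[fun w => (V 0%N w `^ p)%R] < +oo)%E).

Let p0 : 0 <= p. Proof. by apply: le_trans (ltW p2). Qed.
Let E := fine 'E_P[fun w => (V 0%N w `^ p)%R]%E.

(** Off a null set, the overcrowding event and the event of a requirement above [v], the supremum is
    at most [2 * m * v], hence at most [del * Num.sqrt t]. *)
Lemma scaled_sup_grid_tail t del v m : 0 < t -> 0 < v ->
  (2 * m)%:R * v <= del * Num.sqrt t ->
  (P [set w | (del < `|scaled_sup_grid t w|)%R] <=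
  ((Num.truncn t).+1%:R * (2 ^- m.+1 * c) +
   (Num.truncn t + 2 * m)%:R * (E / v `^ p))%:E)%E.
Proof.
move=> t0 v0 mv; set n := Num.truncn t.
have [Z [mZ Z0 Zsub]] : P.-negligible (~` [set w | 0 <= U w <= 1 /\
    (scaled_sup_grid t w)%:E = scaled_sup Vf N t w]).
  have := ae_uniform01; have := scaled_sup_gridE t0.
  by apply: filterS2 => w.
have mC := measurable_overcrowded_before n m.
have mX := measurable_some_exceeds V (n + 2 * m) v.
apply: (@le_trans _ _ (P (Z `|` (overcrowded_before n m `|`
    some_exceeds V (n + 2 * m) v)))).
  apply: le_measure; rewrite ?inE.
  - have mabs : measurable_fun [set: T] (fun w => `|scaled_sup_grid t w|).
      by apply: measurableT_comp => //; exact: measurable_scaled_sup_grid.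
    rewrite -[X in measurable X]setTI.
    exact: (measurable_fun_ltr (measurable_cst del) mabs
      measurableT (Y := [set true])).
  - by do 2 apply: measurableU => //.
  move=> w /= delY; apply: contrapT => /not_orP[nZ /not_orP[nC nX]].
  have [U01 YE] : 0 <= U w <= 1 /\ (scaled_sup_grid t w)%:E = scaled_sup Vf N t w.
    by apply: contrapT => h; apply: nZ; exact: Zsub.
  have Vv i : (i < n + 2 * m)%N -> V i w <= v.
    move=> im; rewrite leNgt; apply/negP => vV; apply: nX.
    rewrite /some_exceeds -(bigcup_mkord _ (fun i => [set w | v < V i w])).
    by exists i.
  have supv := sup_gap_le (ltW t0) U01 nC (ltW v0) Vv.
  have sqt0 : 0 < Num.sqrt t by rewrite sqrtr_gt0.
  move: delY; rewrite ltNge => /negP; apply.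
  have st0 : (0 <= (Num.sqrt t)^-1%:E)%E by rewrite lee_fin invr_ge0 ltW.
  rewrite -lee_fin -abse_EFin YE gee0_abs; last first.
    by apply: (mule_ge0 st0); exact: sup_gap_ge0 (ltW t0).
  apply: le_trans (lee_pmul st0 (sup_gap_ge0 w (ltW t0)) (lexx _) supv) _.
  by rewrite -EFinM lee_fin ler_pdivrMl// [leRHS]mulrC.
apply: le_trans (measureU2 P mZ (measurableU _ _ mC mX)) _.
have PZ : (P Z <= 0)%E by rewrite Z0.
apply: le_trans (leeD PZ (measureU2 P mC mX)) _; rewrite add0e.
rewrite EFinD; apply: leeD; first exact: overcrowded_before_tail.
exact: some_exceeds_tail.
Qed.

(** Both [n <= 2 * 2 ^ q] and [4 * q <= 4 * 2 ^ q] hold. *)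
Let add_log_le (n q : nat) :
  (n < 2 ^ q.+1)%N -> (n + 2 * (2 * q) <= 6 * 2 ^ q)%N.
Proof.
by have := ltn_expl q (ltnSn 1); rewrite expnS; move: (2 ^ q)%N => x; lia.
Qed.

Lemma scaled_sup_grid_cvg (del eta : R) : 0 < del -> 0 < eta ->
  \forall t \near +oo, (P [set w | (del < `|scaled_sup_grid t w|)%R] <= eta%:E)%E.
Proof.
move=> del0 eta0.
have E0 : 0 <= E by apply: fine_ge0; apply: expectation_ge0 => w; exact: powR_ge0.
have c0 : 0 <= c by exact: expR_ge0.
(* [A] collects the constants of the service term: 6 from [add_log_le], and [4 / del] from the level
   [v] below. *)
pose A := 6 * E * (4 / del) `^ p.
have A0 : 0 <= A by rewrite !mulr_ge0// powR_ge0.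
have A1 : 0 < A + 1 by rewrite ltr_wpDl.
have eta2 : 0 < eta / 2 by rewrite divr_gt0.
have half : `|2^-1 : R| < 1 by rewrite ger0_norm// invf_lt1// ltr1n.
have /cvgrPdist_le/(_ _ eta2)[q1 _ q1P] := cvg_geometric c half.
have [q2 q2P] := powR_geometric_small p2 (divr_gt0 eta2 A1).
(* The 1 ensures [q > 0], by which [v] divides. *)
pose q0 := maxn 1 (maxn q1 q2).
near=> t.
have tq0 : (2 ^ q0)%:R <= t by near: t; exact: nbhs_pinfty_ge.
have t0 : 0 < t by apply: lt_le_trans tq0; rewrite ltr0n expn_gt0.
set n := Num.truncn t.
have nq0 : (2 ^ q0 <= n)%N by rewrite truncn_ge_nat// ltW.
have n0 : (0 < n)%N by apply: leq_trans nq0; rewrite expn_gt0.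
pose q := trunc_log 2 n.
have /andP[qn nq] : (2 ^ q <= n < 2 ^ q.+1)%N by exact: trunc_log_bounds.
have : (q0 <= q)%N by exact: trunc_log_max.
rewrite !geq_max => /and3P[q_gt0 qq1 qq2].
have sqt : Num.sqrt 2 ^+ q <= Num.sqrt t.
  rewrite -[leLHS]ger0_norm ?exprn_ge0// -sqrtr_sqr ler_wsqrtr//.
  rewrite exprAC sqr_sqrtr// -natrX; apply: (@le_trans _ _ n%:R).
    by rewrite ler_nat.
  by rewrite truncn_le ltW.
have s2 : 0 < Num.sqrt 2 ^+ q :> R by rewrite exprn_gt0// sqrtr_gt0.
have sqt0 : 0 < Num.sqrt t by rewrite sqrtr_gt0.
have q0R : 0 < q%:R :> R by rewrite ltr0n.
(* The tail bound is applied with [m = 2 * q]; this level makes [2 * m * v] equal to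
   [del * Num.sqrt t]. *)
pose v := del * Num.sqrt t / (4 * q%:R).
have v0 : 0 < v by rewrite divr_gt0 ?mulr_gt0.
apply: le_trans (@scaled_sup_grid_tail t del v (2 * q) t0 v0 _) _.
  rewrite /v mulnA natrM mulrC divfK//; apply: lt0r_neq0; exact: mulr_gt0.
rewrite lee_fin [leRHS]splitr; apply: lerD.
  (* Overcrowding term: [n.+1 <= 2 ^ q.+1] against [2 ^- (2 * q).+1] leaves [2 ^- q], so its bound
     is [c * 2 ^- q]. *)
  have := q1P q qq1; rewrite /geometric/= sub0r normrN => h.
  apply: le_trans h; apply: le_trans (ler_norm _).
  rewrite mulrA mulrC ler_wpM2l// -/n exprVn.
  rewrite ler_pdivrMr ?exprn_gt0//.
  have -> : 2 ^- q * 2 ^+ (2 * q).+1 = (2 ^ q.+1)%:R :> R.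
    rewrite mul2n -addnn -addnS exprD mulKf ?expf_neq0//.
    by rewrite natrX.
  by rewrite ler_nat.
(* Service term: [v^-1] equals [(4 / del) * (q / Num.sqrt t)], and [Num.sqrt t] is at least
   [Num.sqrt 2 ^+ q]. *)
have vp : (v `^ p)^-1 <= (4 / del) `^ p * (q%:R / Num.sqrt 2 ^+ q) `^ p.
  rewrite -powRM ?divr_ge0 ?(ltW s2) ?(ltW del0)//.
  have -> : (v `^ p)^-1 = v^-1 `^ p.
    apply: (mulfI (lt0r_neq0 (powR_gt0 p v0))); rewrite divff ?gt_eqF ?powR_gt0//.
    by rewrite -powRM ?invr_ge0 ?(ltW v0)// divff ?gt_eqF// powR1.
  apply: ge0_ler_powR => //; rewrite ?nnegrE ?invr_ge0 ?(ltW v0)//.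
    by rewrite mulr_ge0// divr_ge0// ltW.
  rewrite /v invf_div mulf_div ler_wpM2l// ?mulr_ge0//.
  by rewrite lef_pV2 ?posrE ?mulr_gt0// ler_pM2l.
have n2q : (n + 2 * (2 * q))%:R <= 6 * 2 ^+ q :> R.
  by rewrite -natrX -(natrM R 6) ler_nat; exact: add_log_le.
apply: (@le_trans _ _ (A * (2 ^+ q * (q%:R / Num.sqrt 2 ^+ q) `^ p))).
  apply: (@le_trans _ _ ((6 * 2 ^+ q) *
      (E * ((4 / del) `^ p * (q%:R / Num.sqrt 2 ^+ q) `^ p)))).
    apply: ler_pM => //; first by rewrite divr_ge0// powR_ge0.
    exact: ler_wpM2l.
  by rewrite /A le_eqVlt; apply/orP; left; apply/eqP; ring.
apply: le_trans (ler_wpM2l A0 (q2P q qq2)) _.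
rewrite mulrA ler_pdivrMr// mulrC ler_pM2l// lerDl.
exact: ler01.
Unshelve. all: end_near. Qed.

End overcrowding.

(* The scaled supremum is a random variable only up to a null event (off which
   the number of arrivals is finite), hence the measurable version Y. *)
Theorem proposition4 (R : realType) (d : measure_display)
    (T : measurableType d) (P : probability T R)
    (xi : int -> {RV P >-> R}) (U : {RV P >-> R}) (V : nat -> {RV P >-> R})
    (p : R)
    (N := arrivals (fun j => xi j : T -> R) U)
    (hxi : iid xi) (hU : uniform01 U)
    (hUxi : independent_systems P
              (sigma_of [set: unit] (fun _ => U : T -> R))
              (sigma_of [set: int] (fun j => xi j : T -> R)))
    (hV : iid V) (hV0 : forall i w, 0 <= V i w)
    (hVN : independent_systems P
             (sigma_of [set: nat] (fun i => V i : T -> R))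
             (sigma_of [set t : R | 0 <= t] N))
    (hxi1 : ('E_P[fun w => `|xi 0%R w|%R] < +oo)%E)
    (hp : 2 < p) (hVp : ('E_P[fun w => (V 0%N w `^ p)%R] < +oo)%E) :
  exists Y : R -> {RV P >-> R},
    (forall t : R, 0 < t ->
      {ae P, forall w,
        (Y t w)%:E = scaled_sup (fun i => V i : T -> R) N t w}) /\
    cvg_in_distribution Y (cst 0).
Proof.
have V0 : forall i w, 0 <= V i w by [].
pose mY t := mem_set (@measurable_scaled_sup_grid _ _ _ P xi U V V0 t)
  : scaled_sup_grid xi U V t \in mfun.
exists (fun t => mfun_Sub (mY t)); split.
  exact: (scaled_sup_gridE hxi hxi1 hU V0).
apply: cvg_prob_cvg_in_distribution => del eta del0 eta0.
exact: (scaled_sup_grid_cvg hxi hxi1 hU V0 hV.2 hp hVp).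
Qed.
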